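(* Let $X$ be a Banach space and let $C\subset X$ be a nonempty convex, closed and bounded set. Then the family $(\mathcal{N}(\mathbb{R}^2)\mathcal{N}(X))'$ of constructible norms for $BLip(C,X)$ modulo collinearity, with the metric $d$ inherited from $\mathcal{N}'(BLip(C,X))$, is a complete metric space.
   Context: For a Banach space $Y$, $\mathcal{N}(Y)$ is the family of all norms on $Y$ equivalent to the given norm. Two norms $p,q\in\mathcal{N}(Y)$ are collinear, $p\sim_c q$, if $q=cp$ for some $c>0$; $\mathcal{N}'(Y)=\mathcal{N}(Y)/\sim_c$. For $p,q\in\mathcal{N}(Y)$ let $u\ge l>0$ be the sharp constants (largest $l$, smallest $u$) with $l\,q(y)\le p(y)\le u\,q(y)$ for all $y\in Y$, and $\varrho(p,q)=u/l$. The metric $d$ on $\mathcal{N}'(Y)$ is $d(\overline{p},\overline{q})=\log\varrho(p,q)$, which is independent of the representatives. For a nonempty $C\subset X$, $T:C\to X$ and $\|\cdot\|\in\mathcal{N}(X)$, put $\|T\|_\infty=\sup_{x\in C}\|Tx\|$ and $K(T,\|\cdot\|)=\sup\{\|Tx-Ty\|/\|x-y\| : x,y\in C,\ x\ne y\}$. $BLip(C,X)$ is the space of maps $T:C\to X$ with $\|T\|_\infty<\infty$ and $K(T,\|\cdot\|)<\infty$; it does not depend on the choice of equivalent norm and is a Banach space under $\|T\|_b=\|T\|_\infty+K(T,\|\cdot\|)$. $\mathcal{N}(BLip(C,X))$ is the family of norms equivalent to $\|\cdot\|_b$. Given $\|\cdot\|\in\mathcal{N}(X)$ and $\theta\in\mathcal{N}(\mathbb{R}^2)$,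 put $\theta\|T\|:=\theta(\|T\|_\infty,K(T,\|\cdot\|))$ for $T\in BLip(C,X)$; $\theta\|\cdot\|$ is called the constructible norm for $BLip(C,X)$ constructed by $\|\cdot\|$ and $\theta$. The family of constructible norms is denoted $\mathcal{N}(\mathbb{R}^2)\mathcal{N}(X)\subset\mathcal{N}(BLip(C,X))$, and $(\mathcal{N}(\mathbb{R}^2)\mathcal{N}(X))'\subset\mathcal{N}'(BLip(C,X))$ is the set of collinearity classes of constructible norms. Since only nonnegative arguments of $\theta$ occur, norms $\theta$ on $\mathbb{R}^2$ are considered only on the first quadrant.
   Formalization: For a norm θ on the plane that is not monotone on the first quadrant, θ‖·‖ can fail the triangle inequality; the family of constructible norms is taken to be those θ‖·‖ that are norms on BLip(C,X) equivalent to the given one. *)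

(* Defs.v *)
From HB Require Import structures.
From mathcomp Require Import all_boot all_order all_algebra.
From mathcomp Require Import all_classical all_reals all_analysis.

Set Implicit Arguments.
Unset Strict Implicit.
Unset Printing Implicit Defensive.

Import Order.TTheory GRing.Theory Num.Theory.
Import numFieldNormedType.Exports.

Local Open Scope classical_set_scope.
Local Open Scope ring_scope.
Local Open Scope quotient_scope.

Section renormings.
Context {R : realType} (Y : normedModType R).

Definition is_norm (p : Y -> R) : Prop :=
  [/\ forall x y, p (x + y) <= p x + p y,
      forall (a : R) x, p (a *: x) = `|a| * p x
    & forall x, p x = 0 -> x = 0].

Definition equivalent_to_given (p : Y -> R) : Prop :=
  exists l u : R, 0 < l /\ forall y, l * `|y| <= p y <= u * `|y|.

(* The set N(Y). *)
Definition renormings : set (Y -> R) :=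
  [set p | is_norm p /\ equivalent_to_given p].

Definition collinear (p q : renormings) : bool :=
  `[< exists2 c : R, 0 < c & forall y, \val q y = c * \val p y >].

Lemma collinear_refl : reflexive collinear.
Proof. by move=> p; apply/asboolP; exists 1 => // y; rewrite mul1r. Qed.

Lemma collinear_sym : symmetric collinear.
Proof.
suff H p q : collinear p q -> collinear q p.
  by move=> p q; apply/idP/idP; exact: H.
move=> /asboolP[c c0 H]; apply/asboolP; exists c^-1; first by rewrite invr_gt0.
by move=> y; rewrite H mulrA mulVf ?mul1r ?gt_eqF.
Qed.

Lemma collinear_trans : transitive collinear.
Proof.
move=> q p r /asboolP[c c0 H] /asboolP[k k0 K]; apply/asboolP.
by exists (k * c); [exact: mulr_gt0|move=> y; rewrite K H mulrA].
Qed.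

Canonical collinear_equiv :=
  EquivRel collinear collinear_refl collinear_sym collinear_trans.

(* The set N'(Y) of collinearity classes. *)
Definition renorming_classes := {eq_quot collinear}.

HB.instance Definition _ := Choice.on renorming_classes.
HB.instance Definition _ := EqQuotient.on renorming_classes.

Definition sharp_upper (p q : Y -> R) : R :=
  inf [set u | forall y, p y <= u * q y].

Definition sharp_lower (p q : Y -> R) : R :=
  sup [set l | forall y, l * q y <= p y].

(* If Y is trivial there are no sharp constants; then [sharp_upper] and       *)
(* [sharp_lower] are 0, so that the logarithm of [norm_ratio p q] is 0.       *)
Definition norm_ratio (p q : Y -> R) : R := sharp_upper p q / sharp_lower p q.

Implicit Types p q r : renormings.

Lemma renorming0 p : \val p 0 = 0.
Proof.
case: p => p /= /set_mem[[_ pZ _] _].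
by have := pZ 0 0; rewrite scale0r normr0 mul0r.
Qed.

Lemma renorming_gt0 p y : y != 0 -> 0 < \val p y.
Proof.
move=> y0; case: p => p /= /set_mem[_ [l [u [l0 H]]]].
have /andP[+ _] := H y; apply: lt_le_trans.
by rewrite mulr_gt0 // normr_gt0.
Qed.

Lemma renorming_ge0 p y : 0 <= \val p y.
Proof.
by have [->|y0] := eqVneq y 0; rewrite ?renorming0 // ltW // renorming_gt0.
Qed.

Lemma renorming_bounds p q :
  exists l u : R, 0 < l /\ forall y, l * \val q y <= \val p y <= u * \val q y.
Proof.
case: p q => [p /= /set_mem[_ [l [u [l0 H]]]]].
case=> [q /= /set_mem[_ [l' [u' [l'0 H']]]]].
have v0 : 0 < Num.max 1 u' by rewrite lt_max ltr01.
exists (l / Num.max 1 u'), (Num.max 1 u / l'); split; first exact: divr_gt0.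
move=> y; have /andP[H1 H2] := H y; have /andP[H'1 H'2] := H' y.
apply/andP; split.
  apply: le_trans H1; rewrite -mulrA ler_wpM2l ?(ltW l0)//.
  rewrite mulrC ler_pdivrMr // mulrC; apply: (le_trans H'2).
  by rewrite ler_wpM2r // le_max lexx orbT.
apply: (le_trans H2).
apply: (@le_trans _ _ (Num.max 1 u * `|y|)).
  by rewrite ler_wpM2r // le_max lexx orbT.
rewrite -mulrA ler_wpM2l ?le_max ?ler01//.
by rewrite mulrC ler_pdivlMr // mulrC.
Qed.

Section nontrivial.
Variables (y0 : Y) (y0_neq0 : y0 != 0).

Lemma sharp_upperP p q y : \val p y <= sharp_upper (\val p) (\val q) * \val q y.
Proof.
have [->|yN] := eqVneq y 0; first by rewrite !renorming0 mulr0.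
rewrite -ler_pdivrMr ?renorming_gt0 //.
apply: lb_le_inf.
  have [l [u [_ H]]] := renorming_bounds p q.
  by exists u => z; have /andP[] := H z.
by move=> u /= /(_ y); rewrite ler_pdivrMr ?renorming_gt0.
Qed.

Lemma sharp_upper_le p q u : (forall y, \val p y <= u * \val q y) ->
  sharp_upper (\val p) (\val q) <= u.
Proof.
move=> H; apply: ge_inf => //; exists (\val p y0 / \val q y0) => v /= /(_ y0).
by rewrite ler_pdivrMr ?renorming_gt0.
Qed.

Lemma sharp_lowerP p q y : sharp_lower (\val p) (\val q) * \val q y <= \val p y.
Proof.
have [->|yN] := eqVneq y 0; first by rewrite !renorming0 mulr0.
rewrite -ler_pdivlMr ?renorming_gt0 //.
apply: ge_sup.
  have [l [u [_ H]]] := renorming_bounds p q.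
  by exists l => z; have /andP[] := H z.
by move=> u /= /(_ y); rewrite ler_pdivlMr ?renorming_gt0.
Qed.

Lemma sharp_lower_ge p q l : (forall y, l * \val q y <= \val p y) ->
  l <= sharp_lower (\val p) (\val q).
Proof.
move=> H; apply: ub_le_sup => //; exists (\val p y0 / \val q y0) => v /= /(_ y0).
by rewrite ler_pdivlMr ?renorming_gt0.
Qed.

Lemma sharp_lower_gt0 p q : 0 < sharp_lower (\val p) (\val q).
Proof.
have [l [u [l0 H]]] := renorming_bounds p q.
by apply: (lt_le_trans l0); apply: sharp_lower_ge => y; have /andP[] := H y.
Qed.

Lemma sharp_lower_le_upper p q :
  sharp_lower (\val p) (\val q) <= sharp_upper (\val p) (\val q).
Proof.
rewrite -(ler_pM2r (renorming_gt0 q y0_neq0)).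
exact: le_trans (sharp_lowerP _ _ _) (sharp_upperP _ _ _).
Qed.

Lemma sharp_upper_gt0 p q : 0 < sharp_upper (\val p) (\val q).
Proof. exact: lt_le_trans (sharp_lower_gt0 p q) (sharp_lower_le_upper p q). Qed.

Lemma norm_ratio_ge1 p q : 1 <= norm_ratio (\val p) (\val q).
Proof.
by rewrite ler_pdivlMr ?mul1r ?sharp_lower_gt0 ?sharp_lower_le_upper.
Qed.

Lemma norm_ratio_gt0 p q : 0 < norm_ratio (\val p) (\val q).
Proof. exact: lt_le_trans ltr01 (norm_ratio_ge1 p q). Qed.

Lemma norm_ratio_le p q (l u : R) : 0 < l ->
  (forall y, l * \val q y <= \val p y <= u * \val q y) ->
  norm_ratio (\val p) (\val q) <= u / l.
Proof.
move=> l0 H.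
have ul : sharp_upper (\val p) (\val q) <= u.
  by apply: sharp_upper_le => y; have /andP[] := H y.
have ll : l <= sharp_lower (\val p) (\val q).
  by apply: sharp_lower_ge => y; have /andP[] := H y.
apply: ler_pM => //.
- exact/ltW/sharp_upper_gt0.
- by rewrite invr_ge0; exact/ltW/sharp_lower_gt0.
- by rewrite lef_pV2 ?posrE ?sharp_lower_gt0.
Qed.

Lemma norm_ratio_sym_le p q :
  norm_ratio (\val p) (\val q) <= norm_ratio (\val q) (\val p).
Proof.
rewrite {2}/norm_ratio -[X in X / _]invrK mulrC.
apply: norm_ratio_le; first by rewrite invr_gt0 sharp_upper_gt0.
move=> y; apply/andP; split.
  by rewrite mulrC ler_pdivrMr ?sharp_upper_gt0 // mulrC sharp_upperP.
by rewrite mulrC ler_pdivlMr ?sharp_lower_gt0 // mulrC sharp_lowerP.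
Qed.

Lemma norm_ratio_trans p q r :
  norm_ratio (\val p) (\val r) <=
  norm_ratio (\val p) (\val q) * norm_ratio (\val q) (\val r).
Proof.
rewrite /norm_ratio mulrACA -invfM; apply: norm_ratio_le.
  by rewrite mulr_gt0 ?sharp_lower_gt0.
move=> y; apply/andP; split.
  apply: le_trans (sharp_lowerP p q y); rewrite -mulrA ler_wpM2l ?sharp_lowerP//.
  exact/ltW/sharp_lower_gt0.
apply: (le_trans (sharp_upperP p q y)); rewrite -mulrA ler_wpM2l ?sharp_upperP//.
exact/ltW/sharp_upper_gt0.
Qed.

Lemma norm_ratio_collinear p q :
  collinear p q -> norm_ratio (\val p) (\val q) = 1.
Proof.
move=> /asboolP[c c0 H]; apply/le_anti/andP; split; last exact: norm_ratio_ge1.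
rewrite -[leRHS](@divff _ c^-1) ?invr_neq0 ?gt_eqF//.
apply: norm_ratio_le; first by rewrite invr_gt0.
by move=> y; rewrite H mulrA mulVf ?gt_eqF// mul1r lexx.
Qed.

Lemma collinear_norm_ratio p q :
  norm_ratio (\val p) (\val q) = 1 -> collinear p q.
Proof.
move=> /divr1_eq E; rewrite collinear_sym; apply/asboolP.
exists (sharp_upper (\val p) (\val q)); first exact: sharp_upper_gt0.
move=> y; apply/le_anti/andP; split; first exact: sharp_upperP.
by rewrite E sharp_lowerP.
Qed.

End nontrivial.

Lemma norm_ratio_trivial p q : (forall y : Y, y = 0) ->
  norm_ratio (\val p) (\val q) = 0.
Proof.
move=> Y0; rewrite /norm_ratio /sharp_lower (_ : [set _ | _] = setT).
  by rewrite sup_out ?invr0 ?mulr0// => -[_ [M /(_ (M + 1) I)]]; rewrite leNgt ltrDl ltr01.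
by apply/seteqP; split=> // l _ y; rewrite (Y0 y) !renorming0 mulr0.
Qed.

Lemma trivial_or_not : (forall y : Y, y = 0) \/ exists y : Y, y != 0.
Proof.
have [H|H] := pselect (exists y : Y, y != 0); [by right|left=> y].
by apply/eqP/negPn/negP => y0; apply: H; exists y.
Qed.

Definition log_ratio p q : R := ln (norm_ratio (\val p) (\val q)).

Lemma log_ratio_trivial p q : (forall y : Y, y = 0) -> log_ratio p q = 0.
Proof. by move=> Y0; rewrite /log_ratio norm_ratio_trivial// ln0. Qed.

Lemma log_ratio_sym p q : log_ratio p q = log_ratio q p.
Proof.
have [Y0|[y0 y0N]] := trivial_or_not; first by rewrite !log_ratio_trivial.
by congr ln; apply/le_anti/andP; split; exact: norm_ratio_sym_le y0N _ _.
Qed.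

Lemma log_ratio_trans q p r : log_ratio p r <= log_ratio p q + log_ratio q r.
Proof.
have [Y0|[y0 y0N]] := trivial_or_not; first by rewrite !log_ratio_trivial// addr0.
have pos := norm_ratio_gt0 y0N.
rewrite /log_ratio -lnM ?posrE ?pos// ler_ln ?posrE ?(mulr_gt0 (pos _ _) (pos _ _)) ?pos//.
exact: norm_ratio_trans y0N _ _ _.
Qed.

Lemma log_ratio_eq0 p q : log_ratio p q = 0 <-> collinear p q.
Proof.
have [Y0|[y0 y0N]] := trivial_or_not.
  split=> [_|_]; last exact: log_ratio_trivial.
  by apply/asboolP; exists 1 => // y; rewrite (Y0 y) !renorming0 mulr0.
have pos := norm_ratio_gt0 y0N.
split=> [E|/(norm_ratio_collinear y0N) E]; last by rewrite /log_ratio E ln1.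
by apply: (collinear_norm_ratio y0N); apply: ln_inj; rewrite ?posrE ?pos// ln1.
Qed.

Definition class_dist (c1 c2 : renorming_classes) : R :=
  log_ratio (repr c1) (repr c2).

Lemma class_distE p q :
  class_dist (\pi_renorming_classes p) (\pi_renorming_classes q) = log_ratio p q.
Proof.
have E s : log_ratio (repr (\pi_renorming_classes s)) s = 0.
  by apply/log_ratio_eq0/eqmodP; rewrite reprK.
rewrite /class_dist; set p' := repr _; set q' := repr _.
have Ep : log_ratio p' p = 0 by exact: E.
have Eq : log_ratio q' q = 0 by exact: E.
apply/le_anti/andP; split.
  rewrite (le_trans (log_ratio_trans p _ _))// Ep add0r.
  by rewrite (le_trans (log_ratio_trans q _ _))// (log_ratio_sym q) Eq addr0.
rewrite (le_trans (log_ratio_trans p' _ _))// (log_ratio_sym p) Ep add0r.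
by rewrite (le_trans (log_ratio_trans q' _ _))// Eq addr0.
Qed.

Lemma class_distxx c : class_dist c c = 0.
Proof. exact/log_ratio_eq0/collinear_refl. Qed.

Lemma class_dist_eq0 c1 c2 : class_dist c1 c2 = 0 -> c1 = c2.
Proof.
by move=> /log_ratio_eq0/eqmodP; rewrite !reprK.
Qed.

Lemma class_dist_sym c1 c2 : class_dist c1 c2 = class_dist c2 c1.
Proof. exact: log_ratio_sym. Qed.

Lemma class_dist_triangle c2 c1 c3 :
  class_dist c1 c3 <= class_dist c1 c2 + class_dist c2 c3.
Proof. exact: log_ratio_trans. Qed.

HB.instance Definition _ := isMetric.Build R renorming_classes
  class_distxx class_dist_eq0 class_dist_sym class_dist_triangle.

End renormings.
Arguments renormings {R} Y _.

Section submetric.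
Context {R : realType} (M : metricType R) (A : set M).

Let dist (x y : A) : R := mdist (\val x) (\val y).

Let dist_ge0 x y : 0 <= dist x y. Proof. exact: mdist_ge0. Qed.

Let dist_positivity x y : dist x y = 0 -> x = y.
Proof. by move=> /mdist_positivity/val_inj. Qed.

Let ballEdist (x : A) e : ball x e = [set y | dist x y < e].
Proof.
rewrite -(@initial_ballE _ A M set_val) ballEmdist.
by apply/seteqP; split=> y; rewrite /dist /= set_valE.
Qed.

(* The library only equips the subtype with the induced pseudometric.         *)
HB.instance Definition _ :=
  PseudoMetric_isMetric.Build R A dist_ge0 dist_positivity ballEdist.

End submetric.

Lemma sup_nneg {R : realType} (A : set R) :
  (forall r, A r -> 0 <= r) -> 0 <= sup A.
Proof.
move=> A0; have [sA|] := pselect (has_sup A); last by move/sup_out => ->.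
have [[r Ar] ubA] := sA.
by rewrite (le_trans (A0 _ Ar))// ub_le_sup.
Qed.

Section blip.
Context {R : realType} {X : normedModType R} (C : set X).
Implicit Types (p : X -> R) (T : C -> X).

Definition lip_ratios p T : set R :=
  [set r | exists x y : C,
             x <> y /\ r = p (T x - T y) / p (\val x - \val y)].

Definition sup_norm p T : R := sup (range (p \o T)).

(* If C is a singleton this is the supremum of the empty set, which is 0.     *)
Definition lip_const p T : R := sup (lip_ratios p T).

Definition blip : {pred C -> X} := fun T =>
  `[< has_ubound (range (Num.norm \o T)) /\
      has_ubound (lip_ratios Num.norm T) >].

Record BLip := MkBLip { blip_fun :> C -> X ; _ : blip_fun \in blip }.

HB.instance Definition _ := [isSub for blip_fun].
HB.instance Definition _ := [Choice of BLip by <:].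

Lemma dist_neq0 (x y : C) : x <> y -> 0 < `|\val x - \val y|.
Proof. by move=> xy; rewrite normr_gt0 subr_eq0; apply/eqP => /val_inj. Qed.

Lemma blipP T : T \in blip <-> exists M : R,
  (forall x, `|T x| <= M) /\ forall x y, `|T x - T y| <= M * `|\val x - \val y|.
Proof.
split=> [/asboolP[[M HM] [L HL]]|[M [HM HL]]].
- exists (Num.max M L); split=> [x|x y].
    by rewrite le_max HM//; exists x.
  have [->|/eqP xy] := eqVneq x y; first by rewrite !subrr normr0 mulr0.
  rewrite -ler_pdivrMr ?dist_neq0// le_max; apply/orP; right.
  by apply: HL; exists x, y.
- apply/asboolP; split; exists M; first by move=> _ [x _ <-]; exact: HM.
  by move=> _ [x [y [xy ->]]]; rewrite ler_pdivrMr ?dist_neq0.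
Qed.

Lemma blip_submod_closed : submod_closed blip.
Proof.
split.
  apply/blipP; exists 0; split=> [x|x y]; first by rewrite normr0.
  by rewrite subrr normr0 mul0r.
move=> a S T /blipP[M [HM HL]] /blipP[N [HN HK]]; apply/blipP.
exists (`|a| * M + N); split=> [x|x y].
  by rewrite (le_trans (ler_normD _ _))// lerD// normrZ ler_wpM2l.
rewrite [X in `|X|](_ : _ = a *: (S x - S y) + (T x - T y)); last first.
  by rewrite scalerBr opprD addrACA.
rewrite (le_trans (ler_normD _ _))// mulrDl lerD// normrZ -mulrA ler_wpM2l//.
Qed.

HB.instance Definition _ := GRing.isSubmodClosed.Build R (C -> X) blip
  blip_submod_closed.
HB.instance Definition _ := [SubChoice_isSubLmodule of BLip by <:].

Lemma sup_norm_ub (T : BLip) x : `|T x| <= sup_norm Num.norm T.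
Proof.
apply: ub_le_sup; last by exists x.
by case: T => T /= /asboolP[].
Qed.

Lemma lip_const_ub (T : BLip) x y :
  `|T x - T y| <= lip_const Num.norm T * `|\val x - \val y|.
Proof.
have [->|/eqP xy] := eqVneq x y; first by rewrite !subrr normr0 mulr0.
rewrite -ler_pdivrMr ?dist_neq0//; apply: ub_le_sup; last by exists x, y.
by case: T => T /= /asboolP[].
Qed.

Lemma sup_norm_ge0 (T : BLip) : 0 <= sup_norm Num.norm T.
Proof. by apply: sup_nneg => _ [x _ <-] /=. Qed.

Lemma lip_const_ge0 (T : BLip) : 0 <= lip_const Num.norm T.
Proof. by apply: sup_nneg => _ [x [y [_ ->]]]; rewrite divr_ge0. Qed.

Lemma sup_norm_le T (M : R) : 0 <= M -> (forall x, `|T x| <= M) ->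
  sup_norm Num.norm T <= M.
Proof.
move=> M0 H; have [E|/set0P S0] := eqVneq (range (Num.norm \o T)) set0.
  by rewrite /sup_norm E sup0.
by apply: ge_sup => // _ [x _ <-]; exact: H.
Qed.

Lemma lip_const_le T (M : R) : 0 <= M ->
  (forall x y, `|T x - T y| <= M * `|\val x - \val y|) ->
  lip_const Num.norm T <= M.
Proof.
move=> M0 H; have [E|/set0P S0] := eqVneq (lip_ratios Num.norm T) set0.
  by rewrite /lip_const E sup0.
apply: ge_sup => // _ [x [y [xy ->]]].
by rewrite ler_pdivrMr ?dist_neq0.
Qed.

Definition blip_norm (T : BLip) : R :=
  sup_norm Num.norm T + lip_const Num.norm T.

Lemma blip_normD (S T : BLip) : blip_norm (S + T) <= blip_norm S + blip_norm T.
Proof.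
rewrite /blip_norm addrACA lerD//.
  apply: sup_norm_le => [|x]; first by rewrite addr_ge0// sup_norm_ge0.
  by rewrite (le_trans (ler_normD _ _))// lerD// sup_norm_ub.
apply: lip_const_le => [|x y]; first by rewrite addr_ge0// lip_const_ge0.
rewrite [X in `|X|](_ : _ = (S x - S y) + (T x - T y)); last first.
  by rewrite /= opprD addrACA.
by rewrite (le_trans (ler_normD _ _))// mulrDl lerD// lip_const_ub.
Qed.

Lemma blip_normZ_le (a : R) (T : BLip) : blip_norm (a *: T) <= `|a| * blip_norm T.
Proof.
rewrite /blip_norm mulrDr lerD//.
  apply: sup_norm_le => [|x]; first by rewrite mulr_ge0// sup_norm_ge0.
  by rewrite normrZ ler_wpM2l// sup_norm_ub.
apply: lip_const_le => [|x y]; first by rewrite mulr_ge0// lip_const_ge0.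
by rewrite /= -scalerBr normrZ -mulrA ler_wpM2l// lip_const_ub.
Qed.

Lemma blip_norm0_eq0 (T : BLip) : blip_norm T = 0 -> T = 0.
Proof.
move=> /eqP; rewrite paddr_eq0 ?sup_norm_ge0 ?lip_const_ge0// => /andP[/eqP T0 _].
apply/val_inj/funext => x /=; apply/normr0_eq0/le_anti.
by rewrite normr_ge0 andbT -T0 sup_norm_ub.
Qed.

Lemma blip_normZ (a : R) (T : BLip) : blip_norm (a *: T) = `|a| * blip_norm T.
Proof.
have [->|a0] := eqVneq a 0.
  apply/le_anti; rewrite blip_normZ_le normr0 mul0r /=.
  by rewrite addr_ge0// ?sup_norm_ge0 ?lip_const_ge0.
apply/le_anti; rewrite blip_normZ_le /=.
rewrite -[X in blip_norm X](scalerK a0 T) -ler_pdivlMl ?normr_gt0//.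
by rewrite -normfV blip_normZ_le.
Qed.

HB.instance Definition _ := Lmodule_isNormed.Build R BLip
  blip_normD blip_normZ blip_norm0_eq0.

End blip.

Section constructible.
Context {R : realType} {X : normedModType R} (C : set X).

(* The normed space [R * R] carries the maximum norm, so that                 *)
(* [renormings (R * R)%type] is the set of all norms on the plane.            *)
Definition constructed_by (p : X -> R) (theta : R * R -> R) (T : BLip C) : R :=
  theta (sup_norm p T, lip_const p T).

(* [constructed_by p theta] need not satisfy the triangle inequality if theta *)
(* is not monotone on the first quadrant; since the family is to be a subset  *)
(* of [renormings (BLip C)], only the theta for which it is a norm there count. *)
Definition constructible : set (renormings (BLip C)) :=
  [set P | exists (p : renormings X) (theta : renormings (R * R)%type),
             \val P = constructed_by (\val p) (\val theta)].

Definition constructible_classes : set (renorming_classes (BLip C)) :=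
  [set \pi_(renorming_classes (BLip C)) P | P in constructible].

End constructible.
Arguments constructible {R X} C _.
Arguments constructible_classes {R X} C _.

Definition complete_metric_space {R : realType} (M : metricType R) : Prop :=
  forall F : set_system M, ProperFilter F -> cauchy F -> exists c : M, F --> c.

(* Main.v *)
Require Import Defs.
From mathcomp Require Import all_boot all_order all_algebra.
From mathcomp Require Import all_classical all_reals all_analysis.
From mathcomp Require Import lra.
Import numFieldNormedType.Exports.
Local Open Scope classical_set_scope.
Local Open Scope ring_scope.
Import Order.TTheory GRing.Theory Num.Theory.
Local Open Scope quotient_scope.

Set Implicit Arguments.
Unset Strict Implicit.
Unset Printing Implicit Defensive.

(** A Cauchy family of constructible norms is passed to the limit along an
    ultrafilter, and each of the three ingredients (the norm on BLip(C,X), the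
    norm on X and the norm on the plane) converges separately, provided that
    their representatives are chosen well.

    Choice of representatives.  On the constant map with value v the norm built
    from p and theta is p(v) theta(1,0).  Replacing p by c p multiplies the sup
    norm by c and leaves the Lipschitz constant alone, so that one may rescale
    until theta(1,0) = 1 and the norm of one fixed nonzero constant map is 1
    ([constructible_normal]).  The first condition makes p the restriction of P
    to the constant maps, so that closeness of the norms P forces closeness of
    the norms p; the second turns a small distance of collinearity classes into
    a uniform estimate P <= k P', P' <= k P between representatives
    ([norm_ratio_close]).

    Limits.  Let F be a Cauchy filter and U an ultrafilter refining it.  Bounded
    real functions converge along U, so that P_i, p_i and theta_i have pointwise
    limits P, p and theta, which are seminorms ([renorming_ultralimit]).  The
    first two are equivalent to any P_i, p_i far enough in F, hence are norms.
    The theta_i are uniformly Lipschitz once theta_i(0,1) is bounded, and the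
    sup norms and Lipschitz constants converge ([sup_norm_cvg],
    [lip_const_cvg]); together this yields P(T) = theta(|T|, K(T)).

    Two points remain.  First, theta_i(0,1) is bounded because any nonconstant
    map T satisfies K_i(T) theta_i(0,1) <= P_i(T) + |T|_i; if all maps are
    constant, the second argument of theta_i is always 0 and theta_i can be
    replaced by the maximum norm ([limit_constructible]).  Secondly, theta may
    degenerate outside of the first quadrant.  But P dominates a multiple l of
    max(|T|, K(T)), and so theta may be replaced by the maximum of theta and
    l times the maximum norm, which is a norm and has the same value at every
    pair (|T|, K(T)) ([plane_max_renorming]). *)

(** * Norms equivalent to the given one *)

Section renorming_lemmas.
Context {R : realType} {Y : normedModType R}.

(** For nontrivial [Y] this is a bound on the two sharp constants separately,
    unlike [norm_ratio], which only sees their quotient; it is therefore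
    meaningful for norms and not for collinearity classes. *)
Definition close_within (k : R) (p q : Y -> R) : Prop :=
  forall y, p y <= k * q y /\ q y <= k * p y.

Definition mk_renorming (p : Y -> R) (pN : renormings Y p) : renormings Y :=
  exist (fun q => q \in renormings Y) p (mem_set pN).

Lemma close_within_sym k p q : close_within k p q -> close_within k q p.
Proof. by move=> H y; have [] := H y. Qed.

Lemma renormingD (p : renormings Y) x y : \val p (x + y) <= \val p x + \val p y.
Proof. by case: p => p /= /set_mem[[]]. Qed.

Lemma renormingZ (p : renormings Y) a y : \val p (a *: y) = `|a| * \val p y.
Proof. by case: p => p /= /set_mem[[]]. Qed.

Lemma renorming_lipschitz (p : renormings Y) x y :
  `|\val p x - \val p y| <= \val p (x - y).
Proof.
have N z : \val p (- z) = \val p z by rewrite -scaleN1r renormingZ normrN1 mul1r.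
have H a b : \val p a <= \val p (a - b) + \val p b.
  by rewrite (le_trans _ (renormingD _ _ _))// subrK.
have Hxy := H x y; have := H y x; rewrite -opprB N => Hyx.
by rewrite ler_norml; apply/andP; split; lra.
Qed.

Lemma seminorm_renorming (Q : Y -> R) (r : renormings Y) (l u : R) :
  (forall x y, Q (x + y) <= Q x + Q y) ->
  (forall a x, Q (a *: x) = `|a| * Q x) ->
  0 < l -> 0 <= u -> (forall y, l * \val r y <= Q y <= u * \val r y) -> renormings Y Q.
Proof.
move=> QD QZ l0 u0 H.
have : exists l' u' : R, 0 < l' /\ forall y, l' * `|y| <= Q y <= u' * `|y|.
  case: r H => r /= /set_mem[_ [l' [u' [l'0 H']]]] H.
  exists (l * l'), (u * u'); split=> [|y]; first exact: mulr_gt0.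
  have /andP[H1 H2] := H y; have /andP[H3 H4] := H' y.
  rewrite -!mulrA; apply/andP; split.
    by apply: le_trans H1; rewrite ler_pM2l.
  by apply: (le_trans H2); rewrite ler_wpM2l.
move=> [l' [u' [l'0 H']]]; split; last by exists l', u'.
split=> // y Qy; apply/eqP; rewrite -normr_le0 -(pmulr_rle0 _ l'0) -Qy.
by have /andP[] := H' y.
Qed.

Lemma norm_renorming : renormings Y Num.norm.
Proof.
split; last by exists 1, 1; split=> // y; rewrite mul1r lexx.
split; [exact: ler_normD|exact: normrZ|by move=> x /eqP; rewrite normr_eq0 => /eqP].
Qed.

(** Agreement at [y0] places 1 between the lower and the upper sharp constant,
    which are thus both controlled by their quotient. *)
Lemma norm_ratio_close (p q : renormings Y) (k : R) (y0 : Y) : y0 != 0 ->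
  \val p y0 = \val q y0 -> norm_ratio (\val p) (\val q) <= k ->
  forall y, \val p y <= k * \val q y.
Proof.
move=> y0N E Hk y; apply: (le_trans (sharp_upperP p q y)).
rewrite ler_wpM2r ?renorming_ge0//; apply: le_trans Hk.
have l0 := sharp_lower_gt0 y0N p q.
rewrite /norm_ratio ler_pdivlMr// ler_piMr ?(ltW (sharp_upper_gt0 y0N p q))//.
by have := sharp_lowerP p q y0; rewrite E ger_pMl ?renorming_gt0.
Qed.

Lemma log_ratio_close (p q : renormings Y) (k : R) : 1 <= k ->
  close_within k (\val p) (\val q) -> log_ratio p q <= ln k + ln k.
Proof.
move=> k1 H.
have k0 : 0 < k by apply: lt_le_trans k1.
have [Y0|[y0 y0N]] := @trivial_or_not R Y.
  by rewrite log_ratio_trivial// addr_ge0// ln_ge0.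
rewrite -lnM ?posrE// ler_ln ?posrE ?(norm_ratio_gt0 y0N) ?mulr_gt0//.
rewrite -[X in _ * X]invrK; apply: (norm_ratio_le y0N); first by rewrite invr_gt0.
by move=> y; have [H1 H2] := H y; rewrite H1 andbT mulrC ler_pdivrMr// mulrC.
Qed.

End renorming_lemmas.

(** * Limits along an ultrafilter *)

Section ultralimits.
Context {R : realType}.

Lemma cvg_ler {I : Type} (F : set_system I) {FF : ProperFilter F} (f g : I -> R)
    (a b : R) : f i @[i --> F] --> a -> g i @[i --> F] --> b ->
  (\forall i \near F, f i <= g i) -> a <= b.
Proof.
move=> fa gb H; rewrite -subr_ge0; apply: (cvgr_to_ge (cvgB gb fa)).
by apply: filterS H => i; rewrite /= subr_ge0.
Qed.

Lemma ultra_fmap {I T : Type} (U : set_system I) {UU : UltraFilter U} (f : I -> T) :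
  UltraFilter (f @ U).
Proof.
split; first exact: fmap_proper_filter.
move=> G GF fG; apply/seteqP; split=> [A GA|]; last exact: fG.
have [//|UnA] := in_ultra_setVsetC (f @^-1` A) UU.
have GnA : G (~` A) by apply: fG.
by have /filter_ex[? []] : G (A `&` ~` A) by exact: filterI.
Qed.

Lemma ultra_cvg {I : Type} (U : set_system I) {UU : UltraFilter U} (f : I -> R)
  (a b : R) : (\forall i \near U, a <= f i <= b) -> cvg (f i @[i --> U]).
Proof.
move=> H; have := @segment_compact R a b; rewrite compact_ultra.
move=> /(_ (f @ U) (ultra_fmap f)) []; last by move=> l [_ fl]; apply/cvg_ex; exists l.
by apply: filterS H => i; rewrite /= in_itv.
Qed.

(** Definiteness may be lost in the limit, hence only a seminorm is obtained. *)
Lemma renorming_ultralimit {Y : normedModType R} {I : Type} (U : set_system I)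
    {UU : UltraFilter U} (q : I -> renormings Y) (b : Y -> R) :
    (forall y, \forall i \near U, \val (q i) y <= b y) ->
  exists Q : Y -> R, [/\ forall y, \val (q i) y @[i --> U] --> Q y,
    forall x y, Q (x + y) <= Q x + Q y & forall a x, Q (a *: x) = `|a| * Q x].
Proof.
move=> H; pose Q y := lim (\val (q i) y @[i --> U]).
have QP y : \val (q i) y @[i --> U] --> Q y.
  apply: (@ultra_cvg _ _ _ _ 0 (b y)).
  by apply: filterS (H y) => i ->; rewrite renorming_ge0.
exists Q; split=> // [x y|a x].
  apply: cvg_ler (QP (x + y)) (cvgD (QP x) (QP y)) _.
  by apply: filterE => i; exact: renormingD.
apply: cvg_lim; first exact: Rhausdorff.
under eq_cvg do rewrite renormingZ.
exact: cvgM (cvg_cst _) (QP x).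
Qed.

Lemma close_within_cvg {Y : normedModType R} {I : Type} (U : set_system I)
    {UU : ProperFilter U} (q : I -> Y -> R) (p Q : Y -> R) k :
    (forall y, q i y @[i --> U] --> Q y) ->
    (\forall i \near U, close_within k p (q i)) -> close_within k p Q.
Proof.
move=> QP H y; split.
  apply: cvg_ler (cvg_cst (p y)) (cvgM (cvg_cst k) (QP y)) _.
  by apply: filterS H => i /(_ y)[].
apply: cvg_ler (QP y) (cvg_cst (k * p y)) _.
by apply: filterS H => i /(_ y)[].
Qed.

(** Convergence in ratio is what closeness of norms provides; it also covers the
    limit 0, where it says that the functions vanish on a set of the filter. *)
Lemma near_ratio_cvg {I : Type} (U : set_system I) {UU : ProperFilter U}
    (f : I -> R) (l : R) : 0 <= l -> (forall i, 0 <= f i) ->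
    (forall k, 1 < k -> \forall i \near U, f i <= k * l /\ l <= k * f i) ->
  f i @[i --> U] --> l.
Proof.
move=> l0 f0 H; apply/cvgrPdist_le => e e0.
(* with k = 1 + d the error is at most d * l, which must not exceed e *)
pose d := e / (l + e); have le0 : 0 < l + e by rewrite ltr_wpDl.
have d0 : 0 < d by rewrite divr_gt0.
have dE : d * (l + e) = e by rewrite /d divfK// gt_eqF.
have := H (1 + d); rewrite ltrDl => /(_ d0).
apply: filterS => i [H1 H2]; rewrite ler_norml.
have d1 : d * l <= e by rewrite -dE ler_pM2l// lerDl ltW.
have := f0 i => fi0.
apply/andP; split; first by lra.
have [fl|fl] := leP (f i) l; last by lra.
have : d * f i <= d * l by rewrite ler_pM2l.
lra.
Qed.

End ultralimits.

(** * Sup norm and Lipschitz constant for an equivalent norm *)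

Section blip_lemmas.
Context {R : realType} {X : normedModType R} {C : set X}.
Implicit Types (p q : renormings X) (T : BLip C).

Lemma renorming_dist_gt0 p (x y : C) : x <> y -> 0 < \val p (\val x - \val y).
Proof.
by move=> xy; rewrite renorming_gt0// subr_eq0; apply/eqP => /val_inj.
Qed.

Lemma sup_norm_renorming_le p T (M : R) : 0 <= M -> (forall x, \val p (T x) <= M) ->
  sup_norm (\val p) T <= M.
Proof.
move=> M0 H; have [E|/set0P S0] := eqVneq (range (\val p \o T)) set0.
  by rewrite /sup_norm E sup0.
by apply: ge_sup => // _ [x _ <-]; exact: H.
Qed.

Lemma lip_const_renorming_le p T (M : R) : 0 <= M ->
  (forall x y, \val p (T x - T y) <= M * \val p (\val x - \val y)) ->
  lip_const (\val p) T <= M.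
Proof.
move=> M0 H; have [E|/set0P S0] := eqVneq (lip_ratios (\val p) T) set0.
  by rewrite /lip_const E sup0.
apply: ge_sup => // _ [x [y [xy ->]]].
by rewrite ler_pdivrMr ?renorming_dist_gt0.
Qed.

Lemma sup_norm_renorming_ub p T x : \val p (T x) <= sup_norm (\val p) T.
Proof.
apply: ub_le_sup; last by exists x.
case: p => p /= /set_mem[_ [l [u [l0 H]]]].
exists (Num.max 0 u * sup_norm Num.norm T) => _ [z _ <-] /=.
have /andP[_ /le_trans->//] := H (T z).
apply: (@le_trans _ _ (Num.max 0 u * `|T z|)).
  by rewrite ler_wpM2r// le_max lexx orbT.
by rewrite ler_wpM2l ?sup_norm_ub// le_max lexx.
Qed.

Lemma lip_const_renorming_ub p T x y :
  \val p (T x - T y) <= lip_const (\val p) T * \val p (\val x - \val y).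
Proof.
have [->|/eqP xy] := eqVneq x y; first by rewrite !subrr renorming0 mulr0.
rewrite -ler_pdivrMr ?renorming_dist_gt0//; apply: ub_le_sup; last by exists x, y.
have := renorming_dist_gt0 p; case: p => p /= /set_mem[_ [l [u [l0 H]]]] pgt0.
exists (Num.max 0 u * lip_const Num.norm T / l) => _ [a [b [ab ->]]].
have m0 : 0 <= Num.max 0 u by rewrite le_max lexx.
rewrite ler_pdivrMr ?pgt0// -!mulrA.
have /andP[_ /le_trans->//] := H (T a - T b).
apply: (@le_trans _ _ (Num.max 0 u * `|T a - T b|)).
  by rewrite ler_wpM2r// le_max lexx orbT.
rewrite ler_wpM2l//; apply: (le_trans (lip_const_ub T a b)).
rewrite ler_wpM2l ?lip_const_ge0// ler_pdivlMl//.
by have /andP[] := H (\val a - \val b).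
Qed.

Lemma sup_norm_renorming_ge0 p T : 0 <= sup_norm (\val p) T.
Proof. by apply: sup_nneg => _ [x _ <-] /=; exact: renorming_ge0. Qed.

Lemma lip_const_renorming_ge0 p T : 0 <= lip_const (\val p) T.
Proof.
by apply: sup_nneg => _ [x [y [_ ->]]]; rewrite divr_ge0 ?renorming_ge0.
Qed.

Lemma sup_norm_dominated k p q T : 0 <= k -> (forall y, \val p y <= k * \val q y) ->
  sup_norm (\val p) T <= k * sup_norm (\val q) T.
Proof.
move=> k0 H; apply: sup_norm_renorming_le => [|x].
  by rewrite mulr_ge0 ?sup_norm_renorming_ge0.
by rewrite (le_trans (H _))// ler_wpM2l// sup_norm_renorming_ub.
Qed.

(** The norm occurs in the numerator and in the denominator of a Lipschitz
    ratio, whence the square. *)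
Lemma lip_const_close k p q T : 0 <= k -> close_within k (\val p) (\val q) ->
  lip_const (\val p) T <= k ^+ 2 * lip_const (\val q) T.
Proof.
move=> k0 H; apply: lip_const_renorming_le => [|x y].
  by rewrite mulr_ge0 ?lip_const_renorming_ge0// exprn_ge0.
have [/le_trans-> //] := H (T x - T y).
rewrite expr2 -!mulrA ler_wpM2l//.
apply: (le_trans (lip_const_renorming_ub q T x y)).
rewrite mulrCA ler_wpM2l ?lip_const_renorming_ge0//.
by have [] := H (\val x - \val y).
Qed.

Lemma cst_blip (v : X) : (fun _ : C => v) \in @blip R X C.
Proof.
apply/blipP; exists `|v|; split=> // x y.
by rewrite subrr normr0 mulr_ge0.
Qed.

Definition cst_BLip (v : X) : BLip C := MkBLip (cst_blip v).

Lemma lip_const_cst p v : lip_const (\val p) (cst_BLip v) = 0.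
Proof.
apply/le_anti; rewrite lip_const_renorming_ge0 andbT.
apply: lip_const_renorming_le => // x y.
by rewrite /= subrr renorming0 mul0r.
Qed.

Lemma sup_norm_cst (x : C) p v : sup_norm (\val p) (cst_BLip v) = \val p v.
Proof.
apply/le_anti/andP; split; last exact: (sup_norm_renorming_ub p (cst_BLip v) x).
by apply: sup_norm_renorming_le => //; exact: renorming_ge0.
Qed.

Context {I : Type} (U : set_system I) {PU : ProperFilter U}.
Context (p : I -> renormings X) (q : renormings X).
Context (pq : forall k, 1 < k ->
  \forall i \near U, close_within k (\val (p i)) (\val q)).

Lemma sup_norm_cvg (T : BLip C) :
  sup_norm (\val (p i)) T @[i --> U] --> sup_norm (\val q) T.
Proof.
apply: near_ratio_cvg => [|i|k k1]; try exact: sup_norm_renorming_ge0.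
have k0 : 0 <= k by lra.
apply: filterS (pq k1) => i H.
by split; apply: sup_norm_dominated => // y; have [] := H y.
Qed.

Lemma lip_const_cvg (T : BLip C) :
  lip_const (\val (p i)) T @[i --> U] --> lip_const (\val q) T.
Proof.
apply: near_ratio_cvg => [|i|k k1]; try exact: lip_const_renorming_ge0.
have k0 : 0 <= k by lra.
have sk1 : 1 < Num.sqrt k by rewrite -[ltLHS]sqrtr1 ltr_sqrt//; lra.
apply: filterS (pq sk1) => i H; rewrite -(sqr_sqrtr k0).
by split; apply: lip_const_close => //; exact: close_within_sym.
Qed.

End blip_lemmas.

(** * Norms on the plane *)

Section plane.
Context {R : realType}.
Implicit Types th : renormings (R * R)%type.

Lemma plane_axis1 th (a : R) : 0 <= a -> \val th (a, 0) = a * \val th (1, 0).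
Proof.
move=> a0; rewrite -[in RHS](ger0_norm a0) -renormingZ; congr (\val th _).
by apply: injective_projections; [exact/esym/mulr1|exact/esym/mulr0].
Qed.

Lemma plane_axis2 th (b : R) : 0 <= b -> \val th (0, b) = b * \val th (0, 1).
Proof.
move=> b0; rewrite -[in RHS](ger0_norm b0) -renormingZ; congr (\val th _).
by apply: injective_projections; [exact/esym/mulr0|exact/esym/mulr1].
Qed.

Lemma plane_le_axes th (x : R * R) :
  \val th x <= `|x.1| * \val th (1, 0) + `|x.2| * \val th (0, 1).
Proof.
rewrite -!renormingZ; apply: le_trans (renormingD _ _ _).
rewrite le_eqVlt; apply/orP; left; apply/eqP; congr (\val th _).
apply: injective_projections.
  by rewrite /= -[LHS]addr0; congr (_ + _); [exact/esym/mulr1|exact/esym/mulr0].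
by rewrite /= -[LHS]add0r; congr (_ + _); [exact/esym/mulr0|exact/esym/mulr1].
Qed.

Lemma plane_rescale th (c : R) : 0 < c ->
  renormings (R * R)%type (fun x => \val th (c * x.1, x.2)).
Proof.
move=> c0; case: th => th /= /set_mem[[thD thZ th0] [l [u [l0 H]]]].
have u0 : 0 <= Num.max 0 u by rewrite le_max lexx.
have K0 : 0 < 1 + c + c^-1 by rewrite !addr_gt0 ?invr_gt0.
have ci0 : 0 < c^-1 by rewrite invr_gt0.
set K := 1 + c + c^-1 in K0 *.
apply: (@seminorm_renorming _ _ _ (mk_renorming (@norm_renorming R (R * R)%type))
          (l / K) (Num.max 0 u * K)).
- by move=> x y; rewrite (le_trans _ (thD _ _))//= mulrDr.
- move=> a x; rewrite -thZ; congr (th (_, _)).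
  by rewrite /= mulrCA.
- exact: divr_gt0.
- by rewrite mulr_ge0// ltW.
move=> x; rewrite [\val _]/=; have /andP[H1 H2] := H (c * x.1, x.2); apply/andP; split.
  apply: le_trans H1; rewrite -mulrA ler_pM2l// ler_pdivrMl//.
  rewrite !prod_normE /= ge_max normrM (gtr0_norm c0); apply/andP; split.
    apply: (@le_trans _ _ (K * (c * `|x.1|))); last first.
      by rewrite ler_pM2l// le_max lexx.
    rewrite mulrA ler_peMl// /K !mulrDl mulVf ?gt_eqF// lerDr addr_ge0 ?mulr_ge0// ltW//.
  apply: (@le_trans _ _ (K * `|x.2|)); last by rewrite ler_pM2l// le_max lexx orbT.
  by rewrite ler_peMl// /K -addrA lerDl addr_ge0// ltW.
apply: (le_trans H2); apply: (@le_trans _ _ (Num.max 0 u * `|(c * x.1, x.2)|)).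
  by rewrite ler_wpM2r// le_max lexx orbT.
rewrite -mulrA ler_wpM2l// prod_normE /= ge_max normrM (gtr0_norm c0); apply/andP; split.
  rewrite ler_pM ?(ltW c0)//; last by rewrite prod_normE /= le_max lexx.
  by rewrite /K; lra.
apply: (@le_trans _ _ (1 * `|x|)).
  by rewrite mul1r prod_normE /= le_max lexx orbT.
by rewrite ler_wpM2r// /K; lra.
Qed.

Lemma plane_norm_ge th :
  exists2 l : R, 0 < l & forall z, l * `|z| <= \val th z.
Proof.
case: th => t /= /set_mem[_ [l [u [l0 Hl]]]].
by exists l => // z; have /andP[] := Hl z.
Qed.

(** A limit of norms on the plane may vanish on a line that meets the first
    quadrant only in 0; the maximum repairs this without changing the values at
    the points where the seminorm already dominates [l * `|x|]. *)
Lemma plane_max_renorming (N : R * R -> R) (l M : R) :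
    (forall x y, N (x + y) <= N x + N y) ->
    (forall a x, N (a *: x) = `|a| * N x) ->
    (forall x, N x <= `|x.1| + `|x.2| * M) -> 0 < l ->
  renormings (R * R)%type (fun x => Num.max (N x) (l * `|x|)).
Proof.
move=> ND NZ NM l0.
apply: (@seminorm_renorming _ _ _ (mk_renorming (@norm_renorming R (R * R)%type))
  l (1 + `|M| + l)) => //.
- move=> x y; rewrite ge_max; apply/andP; split.
    by rewrite (le_trans (ND _ _))// lerD// le_max lexx.
  apply: (@le_trans _ _ (l * `|x| + l * `|y|)).
    by rewrite -mulrDr ler_pM2l// ler_normD.
  by rewrite lerD// le_max lexx orbT.
- by move=> a x; rewrite NZ normrZ mulrCA -maxr_pMr.
- by rewrite !addr_ge0// ltW.
move=> x /=; rewrite le_max lexx orbT /= ge_max; apply/andP; split; last first.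
  by rewrite ler_wpM2r// lerDr addr_ge0.
apply: (@le_trans _ _ (`|x.1| + `|x.2| * `|M|)).
  by rewrite (le_trans (NM x))// lerD2l ler_wpM2l// ler_norm.
rewrite mulrDl mulrDl mul1r -addrA lerD//; first by rewrite prod_normE le_max lexx.
rewrite mulrC ler_wpDr ?mulr_ge0 ?(ltW l0)// ler_wpM2l//.
by rewrite prod_normE le_max lexx orbT.
Qed.

End plane.

(** * Normalised representatives of constructible norms *)

Section normalisation.
Context {R : realType}.

Lemma renorming_scale {Y : normedModType R} (p : renormings Y) (t : R) : 0 < t ->
  renormings Y (fun y => t * \val p y).
Proof.
move=> t0; apply: (@seminorm_renorming _ _ _ p t t) => //.
- by move=> x y; rewrite -mulrDr ler_pM2l// renormingD.
- by move=> a x; rewrite renormingZ mulrCA.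
- exact: ltW.
- by move=> y; rewrite lexx.
Qed.

Context {X : normedModType R} {C : set X}.

Lemma sup_norm_scale (p q : renormings X) (c : R) (T : BLip C) : 0 < c ->
  (forall y, \val q y = c * \val p y) ->
  sup_norm (\val q) T = c * sup_norm (\val p) T.
Proof.
move=> c0 H; apply/le_anti/andP; split.
  by apply: sup_norm_dominated => [|y]; [exact: ltW|rewrite H].
rewrite -ler_pdivlMl//; apply: sup_norm_dominated => [|y].
  by rewrite invr_ge0 ltW.
by rewrite H mulKf ?gt_eqF.
Qed.

Lemma lip_const_scale (p q : renormings X) (c : R) (T : BLip C) : 0 < c ->
  (forall y, \val q y = c * \val p y) ->
  lip_const (\val q) T = lip_const (\val p) T.
Proof.
move=> c0 H; congr sup.
have E a b : \val q a / \val q b = \val p a / \val p b.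
  by rewrite !H -mulf_div divff ?gt_eqF// mul1r.
by apply/seteqP; split=> r [x [y [xy ->]]]; exists x, y; rewrite E.
Qed.

Lemma constructed_by_cst (x0 : C) (p : renormings X) (th : renormings (R * R)%type) v :
  constructed_by (\val p) (\val th) (cst_BLip v : BLip C) = \val p v * \val th (1, 0).
Proof.
by rewrite /constructed_by lip_const_cst (sup_norm_cst x0) plane_axis1 ?renorming_ge0.
Qed.

(** With [a] = theta(1,0) and [t] the inverse of the norm of the constant map, the
    representatives are t a p and (x, y) |-> t theta(x / (t a), y): dividing by
    t a undoes the effect of the new p on the sup norm, and no such correction
    is made for the Lipschitz constant, which is invariant under scaling. *)
Lemma constructible_normal (x0 : C) (v0 : X) (P : renormings (BLip C)) :
    v0 != 0 -> constructible C P ->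
  exists (Q : renormings (BLip C)) (p : renormings X) (th : renormings (R * R)%type),
  [/\ collinear P Q, \val Q = constructed_by (\val p) (\val th),
      \val th (1, 0) = 1 & \val Q (cst_BLip v0) = 1].
Proof.
move=> v0N [p [th PE]].
pose a := \val th (1, 0).
have a0 : 0 < a by apply: renorming_gt0; apply/eqP => -[] /eqP; rewrite oner_eq0.
have P0 : 0 < \val P (cst_BLip v0).
  by rewrite PE (constructed_by_cst x0) mulr_gt0// renorming_gt0.
pose t := (\val P (cst_BLip v0))^-1.
have t0 : 0 < t by rewrite invr_gt0.
have c0 : 0 < t * a by rewrite mulr_gt0.
have ci0 : 0 < (t * a)^-1 by rewrite invr_gt0.
pose thc : renormings (R * R)%type := mk_renorming (plane_rescale th ci0).
exists (mk_renorming (renorming_scale P t0)).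
exists (mk_renorming (renorming_scale p c0)).
exists (mk_renorming (renorming_scale thc t0)); split.
- by apply/asboolP; exists t.
- apply/funext => T; rewrite /= PE /constructed_by /=.
  rewrite (@lip_const_scale p (mk_renorming (renorming_scale p c0)) (t * a))//.
  rewrite (@sup_norm_scale p (mk_renorming (renorming_scale p c0)) (t * a))//.
  by rewrite mulKf ?gt_eqF.
- rewrite /= mulr1 plane_axis1 ?(ltW ci0)// -/a.
  by rewrite mulrCA mulVf ?gt_eqF.
by rewrite /= mulVf ?gt_eqF.
Qed.

End normalisation.

(** * Limits of constructible norms *)

Section constructible_limit.
Context {R : realType} {X : normedModType R} {C : set X}.
Context {I : Type} (F : set_system I) {FF : ProperFilter F}.

Definition norm_cauchy (P : I -> renormings (BLip C)) : Prop :=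
  forall k : R, 1 < k -> exists2 A, F A &
    forall i j, A i -> A j -> close_within k (\val (P i)) (\val (P j)).

Context (P : I -> renormings (BLip C)) (p : I -> renormings X)
  (th : I -> renormings (R * R)%type).
Context
  (PE : forall i, \val (P i) = constructed_by (\val (p i)) (\val (th i)))
  (th1 : forall i, \val (th i) (1, 0) = 1).

Lemma normalised_cst (x0 : C) i v : \val (P i) (cst_BLip v) = \val (p i) v.
Proof. by rewrite PE (constructed_by_cst x0) th1 mulr1. Qed.

Lemma normalised_close (x0 : C) k i j :
  close_within k (\val (P i)) (\val (P j)) ->
  close_within k (\val (p i)) (\val (p j)).
Proof. by move=> H v; rewrite -!(normalised_cst x0); exact: H. Qed.

(** The conclusion is stated for the sets of [F] rather than for those of the
    auxiliary ultrafilter, so that it gives convergence of [F] itself. *)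
Lemma bounded_limit_constructible (x0 : C) (M : R) : norm_cauchy P ->
    (\forall i \near F, \val (th i) (0, 1) <= M) ->
  exists Q : renormings (BLip C), constructible C Q /\
    forall k A, F A ->
      (forall i j, A i -> A j -> close_within k (\val (P i)) (\val (P j))) ->
    forall i, A i -> close_within k (\val (P i)) (\val Q).
Proof.
move=> HC HM.
have [U [UU FU]] := ultraFilterLemma FF.
have PU : ProperFilter U := @ultra_proper _ _ UU.
have [A2 FA2 H2] : exists2 A, F A &
    forall i j, A i -> A j -> close_within 2 (\val (P i)) (\val (P j)).
  by apply: HC; rewrite ltr1n.
have [i0 Ai0] := filter_ex FA2.
have [Q [QP QD QZ]] := @renorming_ultralimit _ _ _ U UU P
  (fun T => 2 * \val (P i0) T)
  (fun T => filterS (fun i Ai => (H2 i i0 Ai Ai0 T).1) (FU _ FA2)).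
have [q [qP qD qZ]] := @renorming_ultralimit _ _ _ U UU p
  (fun v => 2 * \val (p i0) v)
  (fun v => filterS (fun i Ai => (normalised_close x0 (H2 i i0 Ai Ai0) v).1) (FU _ FA2)).
(* the bounds needed for existence of the limits also give theta <= |x.1| + |x.2| M *)
have thM (x : R * R) : \forall i \near U, \val (th i) x <= `|x.1| + `|x.2| * M.
  apply: filterS (FU _ HM) => i Hi.
  rewrite (le_trans (plane_le_axes _ _))// th1 mulr1 lerD2l.
  by rewrite ler_wpM2l.
have [Th [ThP ThD ThZ]] := @renorming_ultralimit _ _ _ U UU th _ thM.
have closeQ k A : F A ->
      (forall i j, A i -> A j -> close_within k (\val (P i)) (\val (P j))) ->
    forall i, A i -> close_within k (\val (P i)) Q.
  move=> FA HA i Ai; apply: close_within_cvg QP _.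
  by apply: filterS (FU _ FA) => j; exact: HA.
have closeq k A : F A ->
      (forall i j, A i -> A j -> close_within k (\val (P i)) (\val (P j))) ->
    forall i, A i -> close_within k (\val (p i)) q.
  move=> FA HA i Ai; apply: close_within_cvg qP _.
  by apply: filterS (FU _ FA) => j Aj; exact: normalised_close x0 _ _ _ (HA _ _ Ai Aj).
have half_le (a b : R) : a <= 2 * b -> 2^-1 * a <= b by lra.
have QN : renormings (BLip C) Q.
  apply: (@seminorm_renorming _ _ _ (P i0) 2^-1 2) => // T.
  by have [H H'] := closeQ 2 A2 FA2 H2 i0 Ai0 T; rewrite half_le.
have qN : renormings X q.
  apply: (@seminorm_renorming _ _ _ (p i0) 2^-1 2) => // v.
  by have [H H'] := closeq 2 A2 FA2 H2 i0 Ai0 v; rewrite half_le.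
pose q' : renormings X := mk_renorming qN.
exists (mk_renorming QN); split; last exact: closeQ.
have pq k : 1 < k -> \forall i \near U, close_within k (\val (p i)) (\val q').
  move=> k1; have [A FA HA] := HC k k1.
  by apply: filterS (FU _ FA) => i; exact: closeq HA i.
have sP (T : BLip C) : sup_norm (\val (p i)) T @[i --> U] --> sup_norm q T.
  exact: (@sup_norm_cvg _ _ _ _ U PU p q').
have lP (T : BLip C) : lip_const (\val (p i)) T @[i --> U] --> lip_const q T.
  exact: (@lip_const_cvg _ _ _ _ U PU p q').
have QE (T : BLip C) : Q T = Th (sup_norm q T, lip_const q T).
  set s := sup_norm q T; set L := lip_const q T.
  (* as th i is Lipschitz with constants 1 and M in the two coordinates on a
     set of U, g i bounds there the error of replacing the arguments s_i, L_i of
     th i by s, L *)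
  pose g i := `|s - sup_norm (\val (p i)) T| + `|L - lip_const (\val (p i)) T| * M.
  have g0 : g i @[i --> U] --> 0.
    rewrite -[X in _ --> X](_ : `|s - s| + `|L - L| * M = 0); last first.
      by rewrite !subrr normr0 mul0r addr0.
    apply: cvgD; first by apply: cvg_norm; apply: cvgB (sP T); exact: cvg_cst.
    apply: cvgM; last exact: cvg_cst.
    by apply: cvg_norm; apply: cvgB (lP T); exact: cvg_cst.
  have Hg : \forall i \near U, `|\val (th i) (s, L) - \val (P i) T| <= g i.
    apply: filterS (FU _ HM) => i Hi.
    rewrite PE /constructed_by (le_trans (renorming_lipschitz _ _ _))//.
    rewrite (le_trans (plane_le_axes _ _))// th1 mulr1 lerD2l.
    by rewrite ler_wpM2l.
  apply/le_anti/andP; split.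
    rewrite -[leRHS]addr0; apply: cvg_ler (QP T) (cvgD (ThP (s, L)) g0) _.
    by apply: filterS Hg => i; rewrite ler_norml => /andP[+ _]; rewrite /=; lra.
  rewrite -[leRHS]addr0; apply: cvg_ler (ThP (s, L)) (cvgD (QP T) g0) _.
  by apply: filterS Hg => i; rewrite ler_norml => /andP[_ +]; rewrite /=; lra.
have [l [l0 Hl]] : exists l : R, 0 < l /\
    forall T : BLip C, l * `|(sup_norm q T, lip_const q T)| <= Q T.
  have [l l0 Hl] := plane_norm_ge (th i0).
  (* passing from i0 to the limit costs a factor 2 for P, and at most 2 ^+ 2 for
     the sup norm and the Lipschitz constant *)
  exists (l / 8); split=> [|T]; first by rewrite divr_gt0.
  have [H _] := closeQ 2 A2 FA2 H2 i0 Ai0 T.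
  have H' := closeq 2 A2 FA2 H2 i0 Ai0.
  have Hs : sup_norm q T <= 2 * sup_norm (\val (p i0)) T.
    by apply: (@sup_norm_dominated _ _ _ _ q' (p i0)) => // y; have [] := H' y.
  have HL : lip_const q T <= 2 ^+ 2 * lip_const (\val (p i0)) T.
    exact: (@lip_const_close _ _ _ _ q' (p i0)) (close_within_sym H').
  have s0 := sup_norm_renorming_ge0 q' T; have L0 := lip_const_renorming_ge0 q' T.
  have s0' := sup_norm_renorming_ge0 (p i0) T.
  have L0' := lip_const_renorming_ge0 (p i0) T.
  rewrite /= in s0 L0.
  move: H; rewrite PE /constructed_by.
  set z := (sup_norm (\val (p i0)) T, _).
  have Hz := Hl z.
  have : `|(sup_norm q T, lip_const q T)| <= 4 * `|z|.
    rewrite !prod_normE /= !ger0_norm// ge_max; apply/andP; split.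
      apply: (@le_trans _ _ (4 * sup_norm (\val (p i0)) T)); first by lra.
      by rewrite ler_pM2l// le_max lexx.
    apply: (@le_trans _ _ (4 * lip_const (\val (p i0)) T)); first by lra.
    by rewrite ler_pM2l// le_max lexx orbT.
  rewrite -(ler_pM2l l0); lra.
have thN : renormings (R * R)%type (fun x => Num.max (Th x) (l * `|x|)).
  apply: (@plane_max_renorming _ _ _ M) => // x.
  exact: (cvgr_to_le (ThP x) (thM x)).
exists q', (mk_renorming thN); apply/funext => T /=.
by rewrite /constructed_by /= -QE max_l.
Qed.

End constructible_limit.

(** Boundedness of theta_i(0,1) can fail only if all maps are constant, and then
    the value of theta_i at (0,1) has no influence on the norm. *)
Lemma limit_constructible {R : realType} {X : normedModType R} {C : set X}
    {I : Type} (F : set_system I) {FF : ProperFilter F}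
    (P : I -> renormings (BLip C)) (p : I -> renormings X)
    (th : I -> renormings (R * R)%type) (x0 : C) :
    (forall i, \val (P i) = constructed_by (\val (p i)) (\val (th i))) ->
    (forall i, \val (th i) (1, 0) = 1) -> norm_cauchy F P ->
  exists Q : renormings (BLip C), constructible C Q /\
    forall k A, F A ->
      (forall i j, A i -> A j -> close_within k (\val (P i)) (\val (P j))) ->
    forall i, A i -> close_within k (\val (P i)) (\val Q).
Proof.
move=> PE th1 HC.
have [A FA HA] : exists2 A, F A &
    forall i j, A i -> A j -> close_within 2 (\val (P i)) (\val (P j)).
  by apply: HC; rewrite ltr1n.
have [i0 Ai0] := filter_ex FA.
have [[T [x [y Txy]]]|H] := pselect (exists (T : BLip C) x y, T x <> T y).
  pose L := lip_const (\val (p i0)) T.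
  have L0 : 0 < L.
    have := lip_const_renorming_ub (p i0) T x y; rewrite -/L => H.
    have Txy0 : 0 < \val (p i0) (T x - T y).
      by rewrite renorming_gt0// subr_eq0; apply/eqP.
    have := lt_le_trans Txy0 H.
    by rewrite pmulr_lgt0// renorming_dist_gt0// => xy; rewrite xy in Txy.
  pose S := 2 * \val (P i0) T + 2 * sup_norm (\val (p i0)) T.
  apply: (bounded_limit_constructible PE th1 x0 (M := 4 * S / L)) => //.
  apply: filterS FA => i Ai.
  have HP := HA _ _ Ai Ai0; have Hp := normalised_close PE th1 x0 HP.
  set s := sup_norm (\val (p i)) T; set Li := lip_const (\val (p i)) T.
  have s0 : 0 <= s := sup_norm_renorming_ge0 (p i) T.
  have Li0 : 0 <= Li := lip_const_renorming_ge0 (p i) T.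
  have HL : L <= 2 ^+ 2 * Li by exact: lip_const_close (close_within_sym Hp).
  have Hs : s <= 2 * sup_norm (\val (p i0)) T.
    by apply: sup_norm_dominated => // z; have [] := Hp z.
  (* (0, Li) is obtained from (s, Li) by a shift of length s along the first axis *)
  have : Li * \val (th i) (0, 1) <= S.
    have := renorming_lipschitz (th i) (0, Li) (s, Li).
    rewrite plane_axis2// ler_norml => /andP[_].
    have := plane_le_axes (th i) ((0, Li) - (s, Li)).
    rewrite /= subrr normr0 mul0r addr0 th1 mulr1 sub0r normrN ger0_norm// => H1 H2.
    have [H3 _] := HP T; move: H3; rewrite {1}PE /constructed_by -/s -/Li /S /=; lra.
  have t0 : 0 <= \val (th i) (0, 1) by exact: renorming_ge0.
  rewrite ler_pdivlMr//; have : \val (th i) (0, 1) * L <= \val (th i) (0, 1) * (2 ^+ 2 * Li).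
    by rewrite ler_wpM2l.
  lra.
have HT (T : BLip C) i : lip_const (\val (p i)) T = 0.
  apply/le_anti; rewrite lip_const_renorming_ge0 andbT.
  apply: lip_const_renorming_le => // x y; rewrite mul0r.
  have -> : T x = T y by apply: contrapT => Txy; apply: H; exists T, x, y.
  by rewrite subrr renorming0.
pose nm := mk_renorming (@norm_renorming R (R * R)%type).
apply: (bounded_limit_constructible (p := p) (th := fun=> nm) (M := 1) _ _ x0) => //.
- move=> i; apply/funext => T; rewrite PE /constructed_by HT.
  have s0 := sup_norm_renorming_ge0 (p i) T.
  rewrite (plane_axis1 (th i) s0) (plane_axis1 nm s0) th1 /= prod_normE /=.
  by rewrite normr1 normr0 max_l.
- by move=> i; rewrite /= prod_normE /= normr1 normr0 max_l.
- by apply: filterE => i; rewrite /= prod_normE /= normr1 normr0 max_r.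
Qed.

(** * Completeness *)

Theorem theorem7p1 (R : realType) (X : completeNormedModType R) (C : set X)
    (C_nonempty : C !=set0) (C_convex : convex_set C) (C_closed : closed C)
    (C_bounded : bounded_set C) :
  complete_metric_space (constructible_classes C).
Proof.
move=> F FF /cauchy_ballP Fcauchy.
have mdistE (c c' : constructible_classes C) P P' :
    \val c = \pi_(renorming_classes (BLip C)) P ->
    \val c' = \pi_(renorming_classes (BLip C)) P' -> mdist c c' = log_ratio P P'.
  by move=> cE cE'; rewrite -class_distE -cE -cE'.
have [BLip0|[T0 T0N]] := @trivial_or_not R (BLip C).
  (* all norms on the zero space are collinear, so any class is a limit *)
  have [c _] := filter_ex (@filterT _ F _).
  exists c; apply/fcvg_ballP => e e0; apply: filterE => c'.
  rewrite ballEmdist /=.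
  by rewrite (mdistE _ _ (repr (\val c)) (repr (\val c'))) ?reprK// log_ratio_trivial.
have [x0 T0x0] : exists x, T0 x != 0.
  apply: contrapT => H; move/eqP: T0N; apply; apply/val_inj/funext => x /=.
  by apply: contrapT => Tx; apply: H; exists x; apply/eqP.
set v0 := T0 x0 in T0x0.
have cstN : cst_BLip v0 != 0 :> BLip C.
  by apply/eqP => /(congr1 (fun T : BLip C => T x0)) /= /eqP; rewrite (negPf T0x0).
have : forall c : constructible_classes C, exists y : renormings (BLip C) *
    (renormings X * renormings (R * R)%type),
    [/\ \val c = \pi_(renorming_classes (BLip C)) y.1,
      \val y.1 = constructed_by (\val y.2.1) (\val y.2.2),
      \val y.2.2 (1, 0) = 1 & \val y.1 (cst_BLip v0) = 1].
  case=> c /= /set_mem[P PC <-].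
  have [Q [p [th [PQ QE th1 Q1]]]] := constructible_normal x0 T0x0 PC.
  by exists (Q, (p, th)); split=> //; apply/eqmodP.
move=> /choice[y yP].
have cE c : \val c = \pi_(renorming_classes (BLip C)) (y c).1 by have [] := yP c.
have yE c : \val (y c).1 = constructed_by (\val (y c).2.1) (\val (y c).2.2).
  by have [] := yP c.
have th1 c : \val (y c).2.2 (1, 0) = 1 by have [] := yP c.
have closeP c c' (k : R) : 1 < k -> mdist c c' < ln k ->
    close_within k (\val (y c).1) (\val (y c').1).
  move=> k1; rewrite (mdistE _ _ _ _ (cE c) (cE c')) => cc'.
  have k0 : 0 < k by lra.
  have [_ _ _ Q1] := yP c; have [_ _ _ Q1'] := yP c'.
  have H (P P' : renormings (BLip C)) : log_ratio P P' < ln k -> norm_ratio (\val P) (\val P') <= k.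
    have pos := norm_ratio_gt0 cstN P P'.
    by rewrite /log_ratio ltr_ln ?posrE// => /ltW.
  split; apply: (norm_ratio_close cstN); rewrite ?Q1 ?Q1'//; apply: H => //.
  by rewrite log_ratio_sym.
have Cauchy : norm_cauchy F (fun c => (y c).1).
  move=> k k1; have lnk : 0 < ln k by rewrite ln_gt0.
  have [[A B] /= [FA FB] AB] := Fcauchy _ lnk.
  exists (A `&` B) => [|c c' [Ac _] [_ Bc']]; first exact: filterI.
  by apply: closeP => //; have := AB (c, c') (conj Ac Bc'); rewrite /= ballEmdist.
have [Q [QC Qlim]] := limit_constructible x0 yE th1 Cauchy.
have QC' : \pi_(renorming_classes (BLip C)) Q \in constructible_classes C.
  by apply/mem_set; exists Q.
pose q : constructible_classes C :=
  exist (fun c => c \in constructible_classes C) _ QC'.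
exists q; apply/fcvg_ballP => e e0.
have k1 : 1 < expR (e / 3) by rewrite expR_gt1 divr_gt0.
have [A FA HA] := Cauchy _ k1; have AQ := Qlim _ _ FA HA.
apply: filterS FA => c Ac; rewrite ballEmdist /=.
rewrite (mdistE q c Q _ erefl (cE c)).
have := log_ratio_close (ltW k1) (close_within_sym (AQ _ Ac)).
by rewrite expRK; lra.
Qed.
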